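(* Let $N\ge 3$, $n\ge 1$, let $a_1,\dots,a_n\in\mathbb{R}^N$ be distinct poles, and let $r_0=\min_{i\ne j}|a_i-a_j|/2$. Let $\beta>0$ and let $\mu\ge 0$ be a weight function on $\mathbb{R}^N$ satisfying the following two hypotheses. $H_1)$ $\nabla\mu\in L^1_{loc}(\mathbb{R}^N)$, $\sqrt{\mu}\in H^1_{loc}(\mathbb{R}^N)$ and $\mu^{-1}\in L^1_{loc}(\mathbb{R}^N)$. $H_2)$ There exist constants $k_1,k_2\in\mathbb{R}$, $k_2>2-N$, such that $$\beta\sum_{i=1}^n\frac{x-a_i}{|x-a_i|^2}\cdot\nabla\mu\ \ge\ \Bigl(-k_1+\sum_{i=1}^n\frac{k_2\beta}{|x-a_i|^2}\Bigr)\mu .$$ Then $$c\int_{\mathbb{R}^N}\sum_{i=1}^n\frac{\varphi^2}{|x-a_i|^2}\,d\mu\ \le\ \int_{\mathbb{R}^N}|\nabla\varphi|^2\,d\mu+K\int_{\mathbb{R}^N}\varphi^2\,d\mu$$ for any $\varphi\in H^1_\mu$, where $c\in\,]0,c_o(N+k_2)[$, $c_o(N+k_2)=\left(\frac{N+k_2-2}{2}\right)^2$, and $K=K(n,c,r_0)$.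
   Context: Here $d\mu(x)=\mu(x)\,dx$ and $L^2_\mu:=L^2(\mathbb{R}^N,d\mu)$. The weighted Sobolev space $H^1_\mu$ is the completion of $C_c^\infty(\mathbb{R}^N)$ with respect to the norm $\|u\|_{H^1_\mu}^2:=\|u\|_{L^2_\mu}^2+\|\nabla u\|_{L^2_\mu}^2$. The parameter $\beta>0$ is the coefficient of the vector field $F(x)=\sum_{i=1}^n\beta\,\frac{x-a_i}{|x-a_i|^2}\,\mu$ used in the vector field method. The notation $K=K(n,c,r_0)$ means a constant depending on $n$, $c$ and $r_0$. *)

(* Defs.v *)
From HB Require Import structures.
From mathcomp Require Import all_boot all_order all_algebra.
From mathcomp Require Import all_classical all_reals all_analysis.
From mathcomp Require Import measurable_realfun.
Set Implicit Arguments.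
Unset Strict Implicit.
Unset Printing Implicit Defensive.
Import Order.TTheory GRing.Theory Num.Theory.
Import numFieldNormedType.Exports.
Local Open Scope classical_set_scope.
Local Open Scope ring_scope.

(* The Borel sigma-algebra of R^n, generated (as for n.-tuple in the library) *)
(* by the coordinate functions.                                               *)
Definition rV_display : measure_display.
Proof. exact: default_measure_display. Qed.

Section measurable_rV.
Variables (R : realType) (n : nat).

Definition rV_coord (i : 'I_n) (x : 'rV[R]_n) : measurableTypeR R := x ord0 i.

Let rV_set0 : g_sigma_preimage rV_coord set0.
Proof. exact: sigma_algebra0. Qed.

Let rV_setC A : g_sigma_preimage rV_coord A -> g_sigma_preimage rV_coord (~` A).
Proof. exact: sigma_algebraC. Qed.

Let rV_bigcup (F : (set 'rV[R]_n)^nat) :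
  (forall i, g_sigma_preimage rV_coord (F i)) ->
  g_sigma_preimage rV_coord (\bigcup_i (F i)).
Proof. exact: sigma_algebra_bigcup. Qed.

HB.instance Definition _ := @isMeasurable.Build rV_display
  'rV[R]_n (g_sigma_preimage rV_coord) rV_set0 rV_setC rV_bigcup.

End measurable_rV.

Lemma measurable_rV_coord (R : realType) n (i : 'I_n) :
  measurable_fun [set: 'rV[R]_n] (rV_coord i).
Proof.
move=> _ Y mY; rewrite setTI; apply: sub_sigma_algebra => /=.
rewrite -bigcup_seq/=; exists i => /=; first by rewrite mem_index_enum.
by exists Y => //; rewrite setTI.
Qed.

Lemma measurable_fun_rVP d (T : measurableType d) (R : realType) n
    (f : T -> 'rV[R]_n) :
  (forall i, measurable_fun [set: T] (rV_coord i \o f)) ->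
  measurable_fun [set: T] f.
Proof.
move=> mf _ A mA; rewrite setTI.
have : (g_sigma_preimage (fun i => rV_coord i \o f)) (f @^-1` A).
  by rewrite g_sigma_preimage_comp; exists A => //; rewrite setTI.
apply: smallest_sub; first exact: sigma_algebra_measurable.
case: n f mf A mA => [|n] f mf A mA; first by rewrite big_ord0.
rewrite -bigcup_mkord_ord; apply: bigcup_sub => i Ii.
by move=> B [C mC <-]; exact: mf.
Qed.

(* R^n * R -> R^(n+1) *)
Definition rV_cons (R : realType) n (p : 'rV[R]_n * measurableTypeR R) :
  'rV[R]_n.+1 := row_mx (const_mx p.2 : 'rV[R]_1) p.1.

Lemma measurable_rV_cons (R : realType) n :
  measurable_fun [set: 'rV[R]_n * measurableTypeR R] (@rV_cons R n).
Proof.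
apply: measurable_fun_rVP => i.
have [j ij|j ij] := split_ordP (i : 'I_(1 + n)).
  rewrite (_ : _ \o _ = snd); first exact: measurable_snd.
  apply/funext => p /=; rewrite /rV_coord /rV_cons ij.
  exact: etrans (row_mxEl _ _ _ _) (mxE _ _ _ _).
rewrite (_ : _ \o _ = rV_coord j \o fst).
  exact: measurableT_comp (measurable_rV_coord j) measurable_fst.
apply/funext => p /=; rewrite /rV_coord /rV_cons ij.
exact: row_mxEr.
Qed.

Section lebesgue_rVS.
Variables (R : realType) (n : nat) (m : {measure set 'rV[R]_n -> \bar R}).

Definition lebesgue_rVS : set 'rV[R]_n.+1 -> \bar R :=
  pushforward (m \x @lebesgue_measure R)%E (@rV_cons R n).

HB.instance Definition _ := Measure.copy lebesgue_rVS
  (measure_function_pushforward__canonical__measure_function_Measure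
     (m \x @lebesgue_measure R)%E (@measurable_rV_cons R n)).

End lebesgue_rVS.

(* n-dimensional Lebesgue measure, as an iterated product measure *)
Fixpoint lebesgue_rV (R : realType) (n : nat) :
    {measure set 'rV[R]_n -> \bar R} :=
  match n with
  | 0 => \d_(0 : 'rV[R]_0)
  | n.+1 => lebesgue_rVS (lebesgue_rV R n)
  end.

Section euclidean.
Variables (R : realType) (N : nat).
Implicit Types x y : 'rV[R]_N.

Definition dotv x y : R := \sum_i x ord0 i * y ord0 i.

(* The library norm `|x| on row vectors is the sup norm. *)
Definition enorm x : R := Num.sqrt (dotv x x).

End euclidean.

Section calculus.
Variables (R : realType) (N : nat).
Implicit Types (f g u : 'rV[R]_N -> R) (F G : 'rV[R]_N -> 'rV[R]_N).
Local Notation leb := (lebesgue_rV R N).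

Definition partial (i : 'I_N) f : 'rV[R]_N -> R :=
  fun x => 'D_(delta_mx ord0 i) f x.

Definition grad f : 'rV[R]_N -> 'rV[R]_N := fun x => \row_i partial i f x.

Fixpoint Ck (k : nat) f : Prop :=
  continuous f /\
  match k with
  | 0 => True
  | k'.+1 => forall i : 'I_N,
      (forall x, derivable f x (delta_mx ord0 i)) /\ Ck k' (partial i f)
  end.

Definition test_function f : Prop :=
  (forall k, Ck k f) /\ compact (closure [set x | f x != 0]).

Definition L1loc (f : 'rV[R]_N -> \bar R) : Prop :=
  measurable_fun setT f /\
  forall A, compact A -> (\int[leb]_(x in A) `|f x| < +oo)%E.

Definition L2loc f : Prop :=
  measurable_fun setT f /\
  forall A, compact A -> (\int[leb]_(x in A) (f x ^+ 2)%R%:E < +oo)%E.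

Definition weak_gradient f G : Prop :=
  [/\ L1loc (EFin \o f),
      forall i, L1loc (fun x => (G x ord0 i)%:E) &
      forall (u : 'rV[R]_N -> R) (i : 'I_N), test_function u ->
        \int[leb]_x (f x * partial i u x) = - \int[leb]_x (G x ord0 i * u x)].

Definition H1loc f : Prop :=
  L2loc f /\
  exists2 G, weak_gradient f G & forall i, L2loc (fun x => G x ord0 i).

End calculus.

Section weighted.
Variables (R : realType) (N : nat) (mu : 'rV[R]_N -> R).
Implicit Types (f : 'rV[R]_N -> R) (G : 'rV[R]_N -> 'rV[R]_N).

(* Integral against dmu = mu(x) dx, for f >= 0. *)
Definition wint f : \bar R := (\int[lebesgue_rV R N]_x (f x * mu x)%R%:E)%E.

Definition H1_sqnorm f G : \bar R :=
  (wint (fun x => f x ^+ 2)%R + wint (fun x => enorm (G x) ^+ 2)%R)%E.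

(* The completion of the test functions for the H^1_mu norm, realised as the  *)
(* closure of { (u, grad u) } in L^2_mu x (L^2_mu)^N; G is the gradient of f  *)
(* in H^1_mu (determined by f almost everywhere when 1/mu is in L^1_loc).     *)
Definition H1_weighted f G : Prop :=
  [/\ measurable_fun setT f, measurable_fun setT G,
      (H1_sqnorm f G < +oo)%E &
      exists2 u : ('rV[R]_N -> R)^nat, (forall k, test_function (u k)) &
        H1_sqnorm (fun x => u k x - f x) (fun x => grad (u k) x - G x)
          @[k --> \oo] --> 0%E].

(* The inverse of mu is taken in \bar R, where 0^-1 = +oo (in R, 0^-1 = 0). *)
Definition hypothesis_H1 (gmu : 'rV[R]_N -> 'rV[R]_N) : Prop :=
  [/\ weak_gradient mu gmu,
      H1loc (fun x => Num.sqrt (mu x)) &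
      L1loc (fun x => ((mu x)%:E^-1)%E)].

Definition hypothesis_H2 n (a : 'I_n -> 'rV[R]_N) (beta k1 k2 : R)
    (gmu : 'rV[R]_N -> 'rV[R]_N) : Prop :=
  {ae lebesgue_rV R N, forall x,
    (- k1 + \sum_i k2 * beta / enorm (x - a i) ^+ 2) * mu x <=
    beta * \sum_i dotv (x - a i) (gmu x) / enorm (x - a i) ^+ 2}.

End weighted.

(* For a single pole the minimum is empty, hence +oo. *)
Definition pole_radius (R : realType) (N n : nat) (a : 'I_n -> 'rV[R]_N) :
  \bar R :=
  \big[Order.min/+oo%E]_(p : 'I_n * 'I_n | p.1 != p.2)
    (enorm (a p.1 - a p.2) / 2)%:E.

Definition hardy_const (R : realType) (d : R) : R := ((d - 2) / 2) ^+ 2.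

(* Main.v *)
(* Test the distributional identity int (mu div w + grad mu . w) = 0 with      *)
(* w = b u^2 eta F, where F = sum_j (x - a_j) / |x - a_j|^2, b = (N + k2 - 2)/2 *)
(* and eta = Q / (Q + e), Q = prod_j |x - a_j|^2: the field w is smooth with   *)
(* compact support, and eta increases along F, so that term can be dropped.    *)
(* As div F = (N - 2) W, W = sum_j |x - a_j|^-2, hypothesis H2 yields           *)
(*   int |grad u|^2 dmu >= int u^2 eta (2 b^2 W - b^2 |F|^2 - b k1 / beta) dmu. *)
(* The diagonal part of |F|^2 is W; since two poles are 2 r0 apart, x is at     *)
(* distance >= r0 from one of them, and every cross term is at most             *)
(* t / |x - a_j|^2 + t / |x - a_k|^2 + 1 / (4 t r0^2).  The choice of t turns   *)
(* b^2 into c.  The inequality passes to H^1_mu with the bounded potential      *)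
(* min (eta W, m), and e -> 0, m -> oo by monotone convergence.                 *)
Require Import Defs.
From mathcomp Require Import all_boot all_order all_algebra.
From mathcomp Require Import all_classical all_reals all_analysis.
From mathcomp Require Import measurable_realfun.
From mathcomp Require Import ring lra.
Set Implicit Arguments.
Unset Strict Implicit.
Unset Printing Implicit Defensive.
Import Order.TTheory GRing.Theory Num.Theory.
Import numFieldNormedType.Exports.
Local Open Scope classical_set_scope.
Local Open Scope ring_scope.

(** Let F be the sum of the fields (x - a_j) / |x - a_j|^2 and W the sum of the |x - a_j|^-2, so
    that div F = (N - 2) W off the poles. Expanding |grad u + b u F|^2 >= 0 and integrating the
    mixed term by parts against mu bounds int |grad u|^2 dmu from below by the integral of b u^2 (mu
    div F + F . grad mu) - b^2 u^2 |F|^2 mu. By H2 the first term is at least b u^2 ((N + k2 - 2) W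
    - k1 / beta) mu. With one pole |F|^2 = W, and b = (N + k2 - 2) / 2 gives the constant c_o = b^2.

    With several poles |F|^2 also has cross terms. Two poles cannot both be near x, so these cost an
    arbitrarily small multiple of W plus a constant ([pole_field_sqr_le]); the gap b^2 - c pays for
    the multiple and K for the constant.

    F is singular, so it is replaced by the smooth field eta F ([reg_field]). The argument above
    then becomes an inequality between integrands ([pointwise_inequality]), and the only integration
    by parts is the definition of the weak gradient of mu ([test_inequality]). [H1_weighted_closure]
    extends the estimate to H^1_mu for bounded potentials, and [wint_inv_sqdist_le] recovers W by
    monotone convergence. *)

(** * Borel sets for the coordinate sigma-algebra *)

Section borel_rV.
Variables (R : realType) (N : nat).

(** Cubes with rational centre and radius 1 / (n + 1) are measurable by construction, and an open
    set is the countable union of those it contains. *)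
Lemma open_measurable_rV (U : set 'rV[R]_N) : open U -> measurable U.
Proof.
move=> oU.
pose B (qn : 'rV[rat]_N * nat) : set 'rV[R]_N :=
  \bigcap_(i in [set: 'I_N])
    (@rV_coord R N i @^-1` ball (ratr (qn.1 ord0 i) : R) qn.2.+1%:R^-1).
have BP qn x : B qn x <->
    forall i, `|ratr (qn.1 ord0 i) - x ord0 i| < qn.2.+1%:R^-1.
  by split=> [H i|H i _]; exact: H.
have mB qn : measurable (B qn).
  apply: fin_bigcap_measurable => // i _; rewrite -[X in measurable X]setTI.
  apply: measurable_rV_coord => //; apply: open_measurable.
  exact: ball_open.
have -> : U = \bigcup_qn (if `[< B qn `<=` U >] then B qn else set0).
  apply/seteqP; split=> [x Ux|x [qn _]]; last by case: asboolP => // + ?; exact.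
  have [d d0 dU] : exists2 d, 0 < d & ball x d `<=` U.
    by have := open_nbhs_nbhs (conj oU Ux); move/nbhs_ballP => [d /= d0 dU]; exists d.
  have d20 : 0 < d / 2 by rewrite divr_gt0.
  have [n _ /(_ n (leqnn n)) /= nd] := near_infty_natSinv_lt (PosNum d20).
  have n0 : (0 : R) < n.+1%:R^-1 by rewrite invr_gt0.
  have qP (i : 'I_N) : exists q : rat, `|ratr q - x ord0 i| < n.+1%:R^-1.
    have [|q] := @rat_in_itvoo R (x ord0 i - n.+1%:R^-1) (x ord0 i + n.+1%:R^-1).
      by rewrite ltrBlDr -addrA ltrDl addr_gt0.
    rewrite in_itv /= => /andP[q1 q2]; exists q.
    by rewrite ltr_norml ltrBrDr ltrBlDl q2 andbT addrC.
  exists (\row_i sval (cid (qP i)), n) => //.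
  have Bx : B (\row_i sval (cid (qP i)), n) x.
    by apply/BP => i /=; rewrite !mxE; case: cid.
  rewrite asboolT // => y /BP /= By; apply: dU; split=> // k i; rewrite (ord1 k).
  rewrite /ball /=; move: Bx By => /BP /= /(_ i) Bx /(_ i) By.
  move: Bx By nd; rewrite !ltr_norml /=.
  move: (n.+1%:R^-1 : R) (ratr _ : R) => e q.
  by move=> /andP[? ?] /andP[? ?] ?; apply/andP; split; lra.
apply: countable_bigcupT_measurable => // qn; case: asboolP => _ //.
Qed.

Lemma closed_measurable_rV (U : set 'rV[R]_N) : closed U -> measurable U.
Proof.
by move=> cU; rewrite -(setCK U); apply: measurableC;
  apply: open_measurable_rV; exact: closed_openC.
Qed.

Lemma compact_measurable_rV (U : set 'rV[R]_N) : compact U -> measurable U.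
Proof. by move=> /compact_closed cU; apply: closed_measurable_rV; exact: cU. Qed.

Lemma continuous_measurable_rV (f : 'rV[R]_N -> R) :
  continuous f -> measurable_fun setT f.
Proof.
move=> cf; apply: (measurability _ (RGenOpens.measurableE R)) => _ [_ [a [b ->] <-]].
by rewrite setTI; apply: open_measurable_rV;
  move/continuousP: cf; apply; exact: interval_open.
Qed.

End borel_rV.

(** The point lies in the hyperplane fixing its first coordinate, whose product measure integrates
    the length of a singleton. In dimension 0 the measure is a Dirac mass, hence the successor. *)
Lemma lebesgue_rV_set1 (R : realType) N (x : 'rV[R]_N.+1) :
  lebesgue_rV R N.+1 [set x] = 0%E.
Proof.
have m1 : measurable [set x].
  by apply: closed_measurable_rV; apply: compact_closed;
    [exact: norm_hausdorff|exact: compact_set1].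
apply/eqP; rewrite eq_le measure_ge0 andbT /= /lebesgue_rVS /pushforward.
have mA : measurable (setT `*` [set x ord0 ord0] : set ('rV[R]_N * measurableTypeR R)).
  by apply: measurableX.
apply: (@le_trans _ _ ((lebesgue_rV R N \x @lebesgue_measure R)%E (setT `*` [set x ord0 ord0]))).
  apply: le_measure; rewrite ?inE //.
    by rewrite -[X in measurable X]setTI; apply: measurable_rV_cons.
  move=> [p t] /= pt; split=> //=; rewrite -pt /rV_cons.
  have -> : (ord0 : 'I_N.+1) = lshift N (ord0 : 'I_1) by apply/val_inj.
  by rewrite (row_mxEl (const_mx t : 'rV_1)) mxE.
rewrite /product_measure1 /= integral0_eq // => y _.
by rewrite in_xsectionX ?inE // lebesgue_measure_set1.
Qed.

(** * Smooth functions and test functions *)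

Section smooth.
Variables (R : realType) (N : nat).
Implicit Types f g u : 'rV[R]_N -> R.

Definition smooth f := forall k, Ck k f.

Lemma CkW k f : Ck k.+1 f -> Ck k f.
Proof.
elim: k f => [|k IH] f; first by move=> [].
by move=> [cf df]; split=> // i; have [? ?] := df i; split=> //; exact: IH.
Qed.

Lemma Ck_cst k (c : R) : Ck k (fun _ : 'rV[R]_N => c).
Proof.
elim: k c => [|k IH] c; first by split=> //; exact: cst_continuous.
split=> [|i]; first exact: cst_continuous.
split=> [x|]; first exact: derivable_cst.
rewrite (_ : partial i _ = fun=> 0); first exact: IH.
by apply/funext => x; exact: derive_cst.
Qed.

Lemma is_derive_coord (x v : 'rV[R]_N) i :
  is_derive x v (fun y : 'rV[R]_N => y ord0 i) (v ord0 i).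
Proof.
suff dc : h^-1 *: ((h *: v + x) ord0 i - x ord0 i) @[h --> 0^'] --> v ord0 i.
  apply: DeriveDef; first by apply/cvg_ex; exists (v ord0 i).
  by apply: cvg_lim => //; exact: norm_hausdorff.
apply: cvg_near_cst.
rewrite nearE; apply/nbhs_ballP; exists 1 => //= h _ h0.
by rewrite !mxE addrK scalerA mulVf // scale1r.
Qed.

Lemma Ck_coord k i : Ck k (fun x : 'rV[R]_N => x ord0 i).
Proof.
case: k => [|k]; first by split=> //; exact: coord_continuous.
split=> [|j]; first exact: coord_continuous.
split=> [x|]; first by have [] := is_derive_coord x (delta_mx ord0 j) i.
rewrite (_ : partial j _ = fun=> (delta_mx ord0 j : 'rV[R]_N) ord0 i); first exact: Ck_cst.
by apply/funext => x; have [_ dx] := is_derive_coord x (delta_mx ord0 j) i.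
Qed.

Lemma CkD k f g : Ck k f -> Ck k g -> Ck k (fun x => f x + g x).
Proof.
elim: k f g => [|k IH] f g [cf df] [cg dg].
  by split=> // x; exact: (cvgD (cf x) (cg x)).
split=> [x|i]; first by exact: (cvgD (cf x) (cg x)).
have [df1 df2] := df i; have [dg1 dg2] := dg i.
split=> [x|]; first exact: derivableD.
rewrite (_ : partial i _ = fun x => partial i f x + partial i g x); first exact: IH.
by apply/funext => x; exact: deriveD.
Qed.

Lemma CkM k f g : Ck k f -> Ck k g -> Ck k (fun x => f x * g x).
Proof.
elim: k f g => [|k IH] f g Cf Cg.
  by split=> // x; exact: (cvgM (Cf.1 x) (Cg.1 x)).
have [cf df] := Cf; have [cg dg] := Cg.
split=> [x|i]; first by exact: (cvgM (cf x) (cg x)).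
have [df1 df2] := df i; have [dg1 dg2] := dg i.
split=> [x|]; first exact: derivableM.
rewrite (_ : partial i _ = fun x => f x * partial i g x + g x * partial i f x).
  by apply: CkD; apply: IH => //; exact: CkW.
by apply/funext => x; exact: deriveM.
Qed.

Lemma CkV k f : (forall x, f x != 0) -> Ck k f -> Ck k (fun x => (f x)^-1).
Proof.
move=> f0; elim: k => [|k IH] Cf.
  by split=> // x; exact: (cvgV (f0 x) (Cf.1 x)).
have [cf df] := Cf; split=> [x|i]; first by exact: (cvgV (f0 x) (cf x)).
have [df1 df2] := df i; split=> [x|]; first exact: derivableV.
rewrite (_ : partial i _ = fun x => (-1) * ((f x)^-1 * (f x)^-1) * partial i f x).
  have CV := IH (CkW Cf).
  by do !apply: CkM => //; exact: Ck_cst.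
apply/funext => x; rewrite /partial deriveV //.
by rewrite -exprVn expr2 mulN1r.
Qed.

Lemma smooth_cst (c : R) : smooth (fun=> c).
Proof. by move=> k; exact: Ck_cst. Qed.

Lemma smooth_coord i : smooth (fun x : 'rV[R]_N => x ord0 i).
Proof. by move=> k; exact: Ck_coord. Qed.

Lemma smoothD f g : smooth f -> smooth g -> smooth (fun x => f x + g x).
Proof. by move=> sf sg k; exact: CkD. Qed.

Lemma smoothM f g : smooth f -> smooth g -> smooth (fun x => f x * g x).
Proof. by move=> sf sg k; exact: CkM. Qed.

Lemma smoothV f : (forall x, f x != 0) -> smooth f -> smooth (fun x => (f x)^-1).
Proof. by move=> f0 sf k; exact: CkV. Qed.

Lemma smooth_sum (I : Type) (r : seq I) (P : pred I) (F : I -> 'rV[R]_N -> R) :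
  (forall i, smooth (F i)) -> smooth (fun x => \sum_(i <- r | P i) F i x).
Proof.
move=> sF; elim: r => [|i r IH].
  by rewrite (_ : (fun _ => _) = fun=> 0);
    [exact: smooth_cst|apply/funext => x; rewrite big_nil].
case: (boolP (P i)) => Pi.
  rewrite (_ : (fun _ => _) = fun x => F i x + \sum_(j <- r | P j) F j x).
    exact: smoothD.
  by apply/funext => x; rewrite big_cons Pi.
by rewrite (_ : (fun _ => _) = fun x => \sum_(j <- r | P j) F j x) //;
  apply/funext => x; rewrite big_cons (negbTE Pi).
Qed.

Lemma smooth_prod (I : Type) (r : seq I) (P : pred I) (F : I -> 'rV[R]_N -> R) :
  (forall i, smooth (F i)) -> smooth (fun x => \prod_(i <- r | P i) F i x).
Proof.
move=> sF; elim: r => [|i r IH].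
  by rewrite (_ : (fun _ => _) = fun=> 1);
    [exact: smooth_cst|apply/funext => x; rewrite big_nil].
case: (boolP (P i)) => Pi.
  rewrite (_ : (fun _ => _) = fun x => F i x * \prod_(j <- r | P j) F j x).
    exact: smoothM.
  by apply/funext => x; rewrite big_cons Pi.
by rewrite (_ : (fun _ => _) = fun x => \prod_(j <- r | P j) F j x) //;
  apply/funext => x; rewrite big_cons (negbTE Pi).
Qed.

Lemma smooth_continuous f : smooth f -> continuous f.
Proof. by move=> /(_ 0%N) []. Qed.

Lemma smooth_derivable f i x : smooth f -> derivable f x (delta_mx ord0 i).
Proof. by move=> /(_ 1%N) [_ /(_ i) []]. Qed.

Lemma smooth_partial f i : smooth f -> smooth (partial i f).
Proof. by move=> sf k; have [_ /(_ i) []] := sf k.+1. Qed.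

Lemma test_functionM f u : smooth f -> test_function u ->
  test_function (fun x => u x * f x).
Proof.
move=> sf [su cu]; split; first exact: smoothM.
apply: (subclosed_compact _ cu); first exact: closed_closure.
by apply: closure_subset => x /=; rewrite mulf_eq0 negb_or => /andP[].
Qed.

(** Off its closed support u vanishes on a neighbourhood, so its partial derivatives vanish there
    too. *)
Lemma test_function_partial u i : test_function u -> test_function (partial i u).
Proof.
move=> [su cu]; split; first exact: smooth_partial.
apply: (subclosed_compact _ cu); first exact: closed_closure.
apply: (@subset_trans _ (closure (closure [set x | u x != 0]))); last first.
  by rewrite closureE; apply: smallest_sub => //; exact: closed_closure.
apply: closure_subset.
move=> y /= uy; apply: contrapT => ycu; move/eqP: uy; apply.
have : \forall z \near y, u z = (fun=> 0) z.
  have : open_nbhs y (~` closure [set x | u x != 0]).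
    by split=> //; apply: closed_openC; exact: closed_closure.
  move=> /open_nbhs_nbhs; apply: filterS => z zcu.
  by apply/eqP; apply: contraT => uz; case: zcu; exact: subset_closure.
by move=> /near_eq_derive yu; rewrite /partial yu derive_cst.
Qed.

End smooth.

(** * Integrability against test functions *)

Section integrability.
Variables (R : realType) (N : nat).
Implicit Types (f u : 'rV[R]_N -> R).
Local Notation leb := (lebesgue_rV R N).

Lemma test_function_bounded u : test_function u ->
  exists2 M, 0 <= M & forall x, `|u x| <= M.
Proof.
move=> [su cu].
have cu' : compact (u @` closure [set x | u x != 0]).
  by apply: continuous_compact => //; apply: continuous_subspaceT; exact: smooth_continuous.
have [M [_ Mu]] := compact_bounded cu'.
exists (Num.max 0 (M + 1)); first by rewrite le_max lexx.
move=> x; have [->|ux] := eqVneq (u x) 0; first by rewrite normr0 le_max lexx.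
rewrite le_max (Mu (M + 1)) ?orbT //; first by rewrite ltrDl.
by exists x => //; exact: subset_closure.
Qed.

(** The product is dominated by M |f| on the compact support of u. *)
Lemma integrable_test f u : L1loc (EFin \o f) -> test_function u ->
  leb.-integrable setT (fun x => (f x * u x)%:E).
Proof.
move=> [mf If] tu; have [M M0 uM] := test_function_bounded tu.
have [su cu] := tu; set A := closure _ in cu.
have mA : measurable A := compact_measurable_rV cu.
have mf' : measurable_fun setT f by exact/measurable_EFinP.
have mfu : measurable_fun setT (fun x => f x * u x).
  by apply: measurable_funM => //; apply: continuous_measurable_rV; exact: smooth_continuous.
apply/integrableP; split; first exact/measurable_EFinP.
apply: (@le_lt_trans _ _ (\int[leb]_(x in A) (M%:E * `|(f x)%:E|))%E).
  rewrite [leRHS]integral_mkcond; apply: ge0_le_integral => //.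
  - by apply: measurableT_comp => //; exact/measurable_EFinP.
  - apply/(measurable_restrictT _ mA)/measurable_funTS.
    by apply: measurable_funeM; apply: measurableT_comp.
  - move=> x _; rewrite patchE; case: ifPn => xA.
      by rewrite /= -EFinM lee_fin normrM mulrC ler_wpM2r.
    have [->|ux] := eqVneq (u x) 0; first by rewrite mulr0 abse0.
    by move: xA; rewrite notin_setE => nA; case: nA; exact: subset_closure.
rewrite ge0_integralZl_EFin //; last first.
  by apply/measurable_funTS; apply: measurableT_comp.
by rewrite lte_mul_pinfty ?lee_fin //; exact: (If A cu).
Qed.

End integrability.

(** * Weighted integrals and passage from test functions to H^1_mu *)

Section weighted_integral.
Variables (R : realType) (N : nat) (mu : 'rV[R]_N -> R).
Hypothesis mu0 : forall x, 0 <= mu x.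
Hypothesis mmu : measurable_fun setT mu.
Implicit Types (f g u : 'rV[R]_N -> R) (G : 'rV[R]_N -> 'rV[R]_N).

Lemma enorm_sqr (x : 'rV[R]_N) : enorm x ^+ 2 = \sum_i x ord0 i ^+ 2.
Proof.
rewrite sqr_sqrtr; last by apply: sumr_ge0 => i _; rewrite -expr2 sqr_ge0.
by apply: eq_bigr => i _; rewrite expr2.
Qed.

Lemma measurable_coord G i : measurable_fun setT G ->
  measurable_fun setT (fun x => G x ord0 i).
Proof. exact: measurableT_comp (measurable_rV_coord i). Qed.

Lemma measurable_enorm_sqr G : (forall i, measurable_fun setT (fun x => G x ord0 i)) ->
  measurable_fun setT (fun x => enorm (G x) ^+ 2).
Proof.
move=> mG; rewrite (_ : (fun _ => _) = fun x => \sum_i G x ord0 i ^+ 2).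
  by apply: measurable_sum => i; exact: measurable_funX.
by apply/funext => x; exact: enorm_sqr.
Qed.

Lemma wint_ge0 f : (forall x, 0 <= f x) -> (0 <= wint mu f)%E.
Proof. by move=> f0; apply: integral_ge0 => x _; rewrite lee_fin mulr_ge0. Qed.

Lemma le_wint f g : measurable_fun setT f -> measurable_fun setT g ->
  (forall x, 0 <= f x) -> (forall x, f x <= g x) -> (wint mu f <= wint mu g)%E.
Proof.
move=> mf mg f0 fg; apply: ge0_le_integral => //.
- by move=> x _; rewrite lee_fin mulr_ge0.
- by apply/measurable_EFinP; exact: measurable_funM.
- by apply/measurable_EFinP; exact: measurable_funM.
- by move=> x _; rewrite lee_fin ler_wpM2r.
Qed.

Lemma wint_lin (a b : R) f g : 0 <= a -> 0 <= b ->
  measurable_fun setT f -> measurable_fun setT g ->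
  (forall x, 0 <= f x) -> (forall x, 0 <= g x) ->
  (wint mu (fun x => (a * f x + b * g x)%R) = a%:E * wint mu f + b%:E * wint mu g)%E.
Proof.
move=> a0 b0 mf mg f0 g0; rewrite /wint.
have mM (h : 'rV[R]_N -> R) : measurable_fun setT h ->
    measurable_fun setT (fun x => (h x * mu x)%:E).
  by move=> mh; apply/measurable_EFinP; exact: measurable_funM.
have M0 (h : 'rV[R]_N -> R) : (forall x, 0 <= h x) ->
    forall x, setT x -> (0 <= (h x * mu x)%:E)%E.
  by move=> h0 x _; rewrite lee_fin mulr_ge0.
rewrite -!ge0_integralZl_EFin //; do ?[exact: M0|exact: mM].
rewrite -ge0_integralD //.
- by apply: eq_integral => x _; rewrite -!EFinM -EFinD; congr EFin; ring.
- by move=> x _; rewrite mule_ge0 ?lee_fin // mulr_ge0.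
- by apply: measurable_funeM; exact: mM.
- by move=> x _; rewrite mule_ge0 ?lee_fin // mulr_ge0.
- by apply: measurable_funeM; exact: mM.
Qed.

(** A multiplicative triangle inequality: it can be integrated in the extended reals without
    subtraction, and the loss 1 + d can be brought back to 1. *)
Lemma sqr_le_perturb (d a b : R) : 0 < d ->
  a ^+ 2 <= (1 + d) * b ^+ 2 + (1 + d^-1) * (b - a) ^+ 2.
Proof.
move=> d0; rewrite -subr_ge0.
have -> : (1 + d) * b ^+ 2 + (1 + d^-1) * (b - a) ^+ 2 - a ^+ 2 =
    (d * b - (a - b)) ^+ 2 / d by field; rewrite gt_eqF.
by rewrite divr_ge0 ?sqr_ge0 // ltW.
Qed.

Lemma enorm_sqr_le_perturb (d : R) (x y : 'rV[R]_N) : 0 < d ->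
  enorm x ^+ 2 <= (1 + d) * enorm y ^+ 2 + (1 + d^-1) * enorm (x - y) ^+ 2.
Proof.
move=> d0; rewrite !enorm_sqr !mulr_sumr -big_split /=; apply: ler_sum => i _.
by rewrite !mxE -(sqrrN (x _ _ - _)) opprB sqr_le_perturb.
Qed.

Lemma measurable_test_function u : test_function u -> measurable_fun setT u.
Proof. by move=> [su _]; apply: continuous_measurable_rV; exact: smooth_continuous. Qed.

Lemma measurable_grad u i : test_function u -> measurable_fun setT (fun x => grad u x ord0 i).
Proof.
move=> tu; rewrite (_ : (fun _ => _) = partial i u).
  by apply: measurable_test_function; exact: test_function_partial.
by apply/funext => x; rewrite mxE.
Qed.

Section closure.
Variables (V : 'rV[R]_N -> R) (M c K : R).
Hypothesis mV : measurable_fun setT V.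
Hypothesis V0 : forall x, 0 <= V x.
Hypothesis VM : forall x, V x <= M.
Hypothesis c0 : 0 <= c.
Hypothesis K0 : 0 <= K.
Hypothesis test_ineq : forall u, test_function u ->
  (c%:E * wint mu (fun x => (u x ^+ 2 * V x)%R) <=
   wint mu (fun x => (enorm (grad u x) ^+ 2)%R) + K%:E * wint mu (fun x => (u x ^+ 2)%R))%E.

Let S f G : \bar R :=
  (wint mu (fun x => (enorm (G x) ^+ 2)%R) + K%:E * wint mu (fun x => (f x ^+ 2)%R))%E.

(** One factor 1 + d is lost in replacing f by u on the left, another in returning from u to f on
    the right. The bound M turns the error in the potential term into an L^2_mu error. *)
Let perturb f G u d : measurable_fun setT f -> measurable_fun setT G ->
  test_function u -> 0 < d ->
  (c%:E * wint mu (fun x => (f x ^+ 2 * V x)%R) <=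
   ((1 + d) ^+ 2)%:E * S f G +
   ((1 + d) * (1 + d^-1) * (1 + K) + c * (1 + d^-1) * M)%:E *
     H1_sqnorm mu (fun x => (u x - f x)%R) (fun x => (grad u x - G x)%R))%E.
Proof.
move=> mf mG tu d0; have dge0 := ltW d0.
have dV0 : 0 <= d^-1 by rewrite invr_ge0.
have d10 : 0 <= 1 + d by rewrite addr_ge0 // ltW.
have d20 : 0 <= 1 + d^-1 by rewrite addr_ge0 // invr_ge0 ltW.
have M0 : 0 <= M by exact: le_trans (V0 0) (VM 0).
have mu' := measurable_test_function tu.
have mG2 : measurable_fun setT (fun x => enorm (G x) ^+ 2).
  by apply: measurable_enorm_sqr => i; exact: measurable_coord.
have mg2 : measurable_fun setT (fun x => enorm (grad u x) ^+ 2).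
  by apply: measurable_enorm_sqr => i; exact: measurable_grad.
have mD2 : measurable_fun setT (fun x => enorm (grad u x - G x) ^+ 2).
  apply: measurable_enorm_sqr => i.
  rewrite (_ : (fun _ => _) = fun x => grad u x ord0 i - G x ord0 i).
    by apply: measurable_funB; [exact: measurable_grad|exact: measurable_coord].
  by apply/funext => x; rewrite !mxE.
have mf2 : measurable_fun setT (fun x => f x ^+ 2) by exact: measurable_funX.
have mu2 : measurable_fun setT (fun x => u x ^+ 2) by exact: measurable_funX.
have muf : measurable_fun setT (fun x => (u x - f x) ^+ 2).
  by apply: measurable_funX; exact: measurable_funB.
set E1 := wint mu (fun x => ((u x - f x) ^+ 2)%R).
set E2 := wint mu (fun x => (enorm (grad u x - G x) ^+ 2)%R).
have E10 : (0 <= E1)%E by apply: wint_ge0 => x; exact: sqr_ge0.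
have E20 : (0 <= E2)%E by apply: wint_ge0 => x; exact: sqr_ge0.
have A0 : (0 <= wint mu (fun x => (enorm (G x) ^+ 2)%R))%E.
  by apply: wint_ge0 => x; exact: sqr_ge0.
have B0 : (0 <= wint mu (fun x => (f x ^+ 2)%R))%E.
  by apply: wint_ge0 => x; exact: sqr_ge0.
have s1 : (wint mu (fun x => (f x ^+ 2 * V x)%R) <=
    (1 + d)%:E * wint mu (fun x => (u x ^+ 2 * V x)%R) + ((1 + d^-1) * M)%:E * E1)%E.
  rewrite -wint_lin ?mulr_ge0 //.
  - apply: le_wint => [|||x].
    + exact: measurable_funM.
    + apply: measurable_funD; apply: measurable_funM => //; exact: measurable_funM.
    + by move=> x; rewrite mulr_ge0 // sqr_ge0.
    + have := sqr_le_perturb (f x) (u x) d0.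
      move=> /(ler_wpM2r (V0 x)) /le_trans; apply.
      have := ler_wpM2l (mulr_ge0 d20 (sqr_ge0 (u x - f x))) (VM x).
      by lra.
  - exact: measurable_funM.
  - by move=> x; rewrite mulr_ge0 // sqr_ge0.
  - by move=> x; exact: sqr_ge0.
have s2 : (wint mu (fun x => (u x ^+ 2)%R) <=
    (1 + d)%:E * wint mu (fun x => (f x ^+ 2)%R) + (1 + d^-1)%:E * E1)%E.
  rewrite -wint_lin // => [|x|x]; try exact: sqr_ge0.
  apply: le_wint => // [|x|x]; last 2 first.
  - exact: sqr_ge0.
  - by rewrite -(sqrrN (u x - f x)) opprB sqr_le_perturb.
  by apply: measurable_funD; apply: measurable_funM.
have s3 : (wint mu (fun x => (enorm (grad u x) ^+ 2)%R) <=
    (1 + d)%:E * wint mu (fun x => (enorm (G x) ^+ 2)%R) + (1 + d^-1)%:E * E2)%E.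
  rewrite -wint_lin // => [|x|x]; try exact: sqr_ge0.
  apply: le_wint => // [|x|x]; last 2 first.
  - exact: sqr_ge0.
  - exact: enorm_sqr_le_perturb.
  by apply: measurable_funD; apply: measurable_funM.
have T := test_ineq tu.
rewrite /S /H1_sqnorm -/E1 -/E2.
(* The integrals are generalised to extended reals; only order arithmetic remains. *)
move: s1 s2 s3 T A0 B0 E10 E20.
move: (wint mu (fun x => (f x ^+ 2 * V x)%R)) => L.
have U0 : (0 <= wint mu (fun x => (u x ^+ 2 * V x)%R))%E.
  by apply: wint_ge0 => x; rewrite mulr_ge0 // sqr_ge0.
move: U0; move: (wint mu (fun x => (u x ^+ 2 * V x)%R)) => U U0.
move: (wint mu (fun x => (u x ^+ 2)%R)) (wint mu (fun x => (enorm (grad u x) ^+ 2)%R)) => u2 g2.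
move: (wint mu (fun x => (f x ^+ 2)%R)) (wint mu (fun x => (enorm (G x) ^+ 2)%R)) => B A.
move: E1 E2 => E1 E2 s1 s2 s3 T A0 B0 E10 E20.
have h1 : (c%:E * L <= (1 + d)%:E * (g2 + K%:E * u2) + (c * (1 + d^-1) * M)%:E * E1)%E.
  apply: (le_trans (lee_wpmul2l _ s1)); first by rewrite lee_fin.
  rewrite ge0_muleDr ?mule_ge0 ?lee_fin ?mulr_ge0 //.
  rewrite muleCA leeD //; first by apply: lee_wpmul2l => //; rewrite lee_fin.
  by rewrite muleA -EFinM mulrA.
apply: (le_trans h1).
have h2 : (g2 + K%:E * u2 <= (1 + d)%:E * (A + K%:E * B) +
    ((1 + d^-1) * (1 + K))%:E * (E1 + E2))%E.
  apply: (le_trans (leeD s3 (lee_wpmul2l _ s2))); first by rewrite lee_fin.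
  rewrite [X in (_ + X)%E]ge0_muleDr ?mule_ge0 ?lee_fin //.
  rewrite [X in (_ <= X + _)%E]ge0_muleDr ?mule_ge0 ?lee_fin //.
  rewrite addeACA (muleCA K%:E (1 + d)%:E B) leeD2l //.
  rewrite [leRHS]ge0_muleDr // addeC; apply: leeD; rewrite ?muleA -?EFinM.
    by rewrite lee_wpmul2r // lee_fin mulrC ler_wpM2l // lerDr.
  by rewrite lee_wpmul2r // lee_fin ler_peMr // lerDl.
apply: (le_trans (leeD (lee_wpmul2l _ h2) (lee_wpmul2l _ (_ : E1 <= E1 + E2)%E))).
- by rewrite lee_fin.
- by rewrite lee_fin !mulr_ge0.
- by rewrite leeDl.
rewrite ge0_muleDr ?mule_ge0 ?adde_ge0 ?mule_ge0 ?lee_fin ?mulr_ge0 ?addr_ge0 //.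
rewrite -addeA leeD //; first by rewrite muleA -EFinM expr2.
rewrite muleA -EFinM -ge0_muleDl ?lee_fin ?mulr_ge0 ?addr_ge0 //.
by rewrite -EFinD mulrA.
Qed.

(** For fixed d the error in [perturb] vanishes along the approximating sequence; then d tends to 0,
    which removes (1 + d)^2 because the right-hand side is finite. *)
Lemma H1_weighted_closure f G : H1_weighted mu f G ->
  (c%:E * wint mu (fun x => (f x ^+ 2 * V x)%R) <=
   wint mu (fun x => (enorm (G x) ^+ 2)%R) + K%:E * wint mu (fun x => (f x ^+ 2)%R))%E.
Proof.
move=> [mf mG fin [u tu cu]].
have M0 : 0 <= M by exact: le_trans (V0 0) (VM 0).
have A0 : (0 <= wint mu (fun x => (enorm (G x) ^+ 2)%R))%E.
  by apply: wint_ge0 => x; exact: sqr_ge0.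
have B0 : (0 <= wint mu (fun x => (f x ^+ 2)%R))%E.
  by apply: wint_ge0 => x; exact: sqr_ge0.
have [s Ss s0] : exists2 s, S f G = s%:E & 0 <= s.
  have S0 : (0 <= S f G)%E by rewrite adde_ge0 // mule_ge0 // lee_fin.
  have : (S f G < +oo)%E.
    move: fin; rewrite /H1_sqnorm => fin; apply: lte_add_pinfty.
      by apply: le_lt_trans fin; rewrite leeDr.
    apply: lte_mul_pinfty; rewrite ?lee_fin //.
    by apply: le_lt_trans fin; rewrite leeDl.
  by case: (S f G) S0 => // s s0 _; exists s => //; rewrite -lee_fin.
rewrite -/(S f G).
have step d : 0 < d ->
    (c%:E * wint mu (fun x => (f x ^+ 2 * V x)%R) <= ((1 + d) ^+ 2 * s)%:E)%E.
  move=> d0; apply/lee_addgt0Pr => e e0.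
  set C := (1 + d) * (1 + d^-1) * (1 + K) + c * (1 + d^-1) * M.
  have C0 : 0 < C.
    have dV0 : 0 <= d^-1 by rewrite invr_ge0 ltW.
    apply: ltr_pwDl; first by rewrite !mulr_gt0 // ltr_pwDl // ltW.
    by rewrite !mulr_ge0 // addr_ge0.
  have [k Ek] : exists k, (H1_sqnorm mu (fun x => (u k x - f x)%R)
      (fun x => (grad (u k) x - G x)%R) < (e / C)%:E)%E.
    have : \forall k \near \oo, (H1_sqnorm mu (fun x => (u k x - f x)%R)
      (fun x => (grad (u k) x - G x)%R) < (e / C)%:E)%E.
      apply: (cu [set x : \bar R | (x < (e / C)%:E)%E]).
      by apply: open_ereal_lt'; rewrite lte_fin divr_gt0.
    by move=> [k _ /(_ k (leqnn k))]; exists k.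
  apply: (le_trans (perturb mf mG (tu k) d0)).
  rewrite Ss -EFinM leeD2l // (le_trans (lee_wpmul2l _ (ltW Ek))) ?(ltW C0) //.
    by rewrite lee_fin ltW.
  by rewrite -EFinM mulrC divfK ?gt_eqF.
rewrite Ss; apply/lee_addgt0Pr => e e0.
have s1 : 0 < 3 * (s + 1) by rewrite mulr_gt0 // ltr_wpDl.
(* As d <= 1, (1 + d)^2 s <= s + 3 d s, and this d makes 3 d s at most e; s + 1 keeps the
   denominator positive. *)
pose d := Num.min 1 (e / (3 * (s + 1))).
have d0 : 0 < d by rewrite lt_min ltr01 divr_gt0.
have d1 : d <= 1 by rewrite ge_min lexx.
have de : d * (3 * (s + 1)) <= e by rewrite -ler_pdivlMr // ge_min lexx orbT.
apply: (le_trans (step _ d0)); rewrite -EFinD lee_fin.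
have dd : d * d <= d by rewrite ler_piMl // ltW.
have ds : d * d * s <= d * s by rewrite ler_wpM2r.
have -> : (1 + d) ^+ 2 * s = s + 2 * (d * s) + d * d * s by ring.
by move: de d0 ds; rewrite mulrCA mulrDr mulr1; lra.
Qed.

End closure.
End weighted_integral.

(** * Derivatives of sums and products *)

Lemma is_derive_mulr (R : realType) (N : nat) (f g : 'rV[R]_N -> R)
    (x v : 'rV[R]_N) (df dg : R) :
  is_derive x v f df -> is_derive x v g dg ->
  is_derive x v (fun y => f y * g y) (f x * dg + g x * df).
Proof. by move=> Df Dg; exact: is_deriveM. Qed.

Lemma is_derive_sumr (R : realType) (N n : nat) (f : 'I_n -> 'rV[R]_N -> R)
    (x v : 'rV[R]_N) (df : 'I_n -> R) :
  (forall i, is_derive x v (f i) (df i)) ->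
  is_derive x v (fun y => \sum_i f i y) (\sum_i df i).
Proof.
move=> Df; rewrite (_ : (fun _ => _) = \sum_i f i); first exact: is_derive_sum.
by apply/funext => y; rewrite fct_sumE.
Qed.

(** Logarithmic differentiation, legitimate because no factor vanishes at x. *)
Lemma is_derive_prod (R : realType) (N : nat) (I : Type) (r : seq I) (P : pred I)
    (f : I -> 'rV[R]_N -> R) (df : I -> R) (x v : 'rV[R]_N) :
  (forall i, is_derive x v (f i) (df i)) -> (forall i, f i x != 0) ->
  is_derive x v (fun y => \prod_(i <- r | P i) f i y)
    (\prod_(i <- r | P i) f i x * \sum_(i <- r | P i) df i / f i x).
Proof.
move=> Df f0; elim: r => [|i r IH].
  rewrite (_ : (fun _ => _) = cst 1); last by apply/funext => y; rewrite big_nil.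
  by rewrite !big_nil mulr0; exact: is_derive_cst.
rewrite !big_cons; case: (boolP (P i)) => Pi; last first.
  rewrite (_ : (fun _ => _) = fun y => \prod_(j <- r | P j) f j y) //.
  by apply/funext => y; rewrite big_cons (negbTE Pi).
rewrite (_ : (fun _ => _) = fun y => f i y * \prod_(j <- r | P j) f j y); last first.
  by apply/funext => y; rewrite big_cons Pi.
apply: (is_derive_eq (is_derive_mulr (Df i) IH)).
by field; exact: f0.
Qed.

(** * The regularised field and its divergence *)

Section poles.
Variables (R : realType) (N n : nat) (a : 'I_n -> 'rV[R]_N).
Implicit Types (x : 'rV[R]_N) (i : 'I_N) (j k : 'I_n).

Definition sqdist j x := \sum_i (x ord0 i - a j ord0 i) ^+ 2.

Definition sqdist_prod x := \prod_j sqdist j x.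

Definition inv_sqdist_sum x := \sum_j (sqdist j x)^-1.

Definition pole_field i x := \sum_j (x ord0 i - a j ord0 i) / sqdist j x.

(* Off the poles these are eta * pole_field and eta * inv_sqdist_sum, where    *)
(* eta = Q / (Q + e) and Q = sqdist_prod.                                       *)
Definition reg_field e i x :=
  (\sum_j (x ord0 i - a j ord0 i) * \prod_(k | k != j) sqdist k x) /
  (sqdist_prod x + e).

Definition reg_potential e x :=
  (\sum_j \prod_(k | k != j) sqdist k x) / (sqdist_prod x + e).

Lemma enorm_sub_sqr j x : enorm (x - a j) ^+ 2 = sqdist j x.
Proof. by rewrite enorm_sqr; apply: eq_bigr => i _; rewrite !mxE. Qed.

Lemma sqdist_ge0 j x : 0 <= sqdist j x.
Proof. by apply: sumr_ge0 => i _; exact: sqr_ge0. Qed.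

Lemma sqdist_eq0 j x : sqdist j x = 0 -> x = a j.
Proof.
move=> /eqP; rewrite psumr_eq0 => [/allP H|i _]; last exact: sqr_ge0.
apply/rowP => i; apply/eqP; rewrite -subr_eq0 -sqrf_eq0.
by have := H i (mem_index_enum i).
Qed.

Lemma prod_sqdist_ge0 (P : pred 'I_n) x : 0 <= \prod_(k | P k) sqdist k x.
Proof. by apply: prodr_ge0 => k _; exact: sqdist_ge0. Qed.

Lemma smooth_coordB j i : smooth (fun x => x ord0 i - a j ord0 i).
Proof. by apply: smoothD; [exact: smooth_coord|exact: smooth_cst]. Qed.

Lemma smooth_sqdist j : smooth (sqdist j).
Proof.
apply: smooth_sum => i.
by apply: smoothM; exact: smooth_coordB.
Qed.

Section regularization.
Variable e : R.
Hypothesis e0 : 0 < e.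

Lemma sqdist_prodD_gt0 x : 0 < sqdist_prod x + e.
Proof. by rewrite ltr_wpDl // prod_sqdist_ge0. Qed.

Lemma smooth_inv_sqdist_prodD : smooth (fun x => (sqdist_prod x + e)^-1).
Proof.
apply: smoothV => [x|]; first by rewrite gt_eqF // sqdist_prodD_gt0.
by apply: smoothD; [apply: smooth_prod => j; exact: smooth_sqdist|exact: smooth_cst].
Qed.

Lemma smooth_reg_field i : smooth (reg_field e i).
Proof.
apply: smoothM; last exact: smooth_inv_sqdist_prodD.
apply: smooth_sum => j; apply: smoothM; first exact: smooth_coordB.
by apply: smooth_prod => k; exact: smooth_sqdist.
Qed.

Lemma smooth_reg_potential : smooth (reg_potential e).
Proof.
apply: smoothM; last exact: smooth_inv_sqdist_prodD.
by apply: smooth_sum => j; apply: smooth_prod => k; exact: smooth_sqdist.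
Qed.

Lemma reg_potential_ge0 x : 0 <= reg_potential e x.
Proof.
rewrite divr_ge0 ?(ltW (sqdist_prodD_gt0 x)) //.
by apply: sumr_ge0 => j _; exact: prod_sqdist_ge0.
Qed.

End regularization.

Section off_poles.
Variable x : 'rV[R]_N.
Hypothesis x0 : forall j, sqdist j x != 0.

Lemma sqdist_prod_gt0 : 0 < sqdist_prod x.
Proof. by apply: prodr_gt0 => j _; rewrite lt_def x0 sqdist_ge0. Qed.

Lemma prod_sqdist_neq j : \prod_(k | k != j) sqdist k x = sqdist_prod x / sqdist j x.
Proof. by rewrite /sqdist_prod [in RHS](bigD1 j) //= mulrAC mulfV ?mul1r. Qed.

Lemma reg_fieldE e i :
  reg_field e i x = sqdist_prod x / (sqdist_prod x + e) * pole_field i x.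
Proof.
rewrite /reg_field mulrAC; congr (_ / _); rewrite mulr_sumr.
by apply: eq_bigr => j _; rewrite prod_sqdist_neq; ring.
Qed.

Lemma reg_potentialE e :
  reg_potential e x = sqdist_prod x / (sqdist_prod x + e) * inv_sqdist_sum x.
Proof.
rewrite /reg_potential mulrAC; congr (_ / _); rewrite mulr_sumr.
by apply: eq_bigr => j _; rewrite prod_sqdist_neq.
Qed.

Let v i : 'rV[R]_N := delta_mx ord0 i.

Lemma is_derive_coordB j i i' :
  is_derive x (v i) (fun y => y ord0 i' - a j ord0 i') (i' == i)%:R.
Proof.
have D := is_deriveB (is_derive_coord x (v i) i') (is_derive_cst (a j ord0 i') x (v i)).
by apply: (is_derive_eq D); rewrite subr0 !mxE.
Qed.

Lemma is_derive_sqdist j i :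
  is_derive x (v i) (sqdist j) (2 * (x ord0 i - a j ord0 i)).
Proof.
have E := is_derive_sumr
  (fun i' => is_derive_mulr (is_derive_coordB j i i') (is_derive_coordB j i i')).
by apply: (is_derive_eq E); rewrite (bigD1 i) //= eqxx big1 => [|i' /negbTE ->] /=; ring.
Qed.

(** The logarithmic derivative of Q is 2 F_i; leaving out the factor j removes the j-th summand of
    F_i. *)
Lemma is_derive_prod_sqdist_neq j i :
  is_derive x (v i) (fun y => \prod_(k | k != j) sqdist k y)
    (sqdist_prod x / sqdist j x *
     (2 * (pole_field i x - (x ord0 i - a j ord0 i) / sqdist j x))).
Proof.
have D := is_derive_prod (index_enum 'I_n) (fun k => k != j)
  (fun k => is_derive_sqdist k i) x0.
apply: (is_derive_eq D); rewrite prod_sqdist_neq; congr (_ * _).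
rewrite /pole_field [in RHS](bigD1 j) //= addrAC subrr add0r mulr_sumr.
by apply: eq_bigr => k _; rewrite mulrA.
Qed.

Lemma is_derive_sqdist_prod i :
  is_derive x (v i) sqdist_prod (sqdist_prod x * (2 * pole_field i x)).
Proof.
have D := is_derive_prod (index_enum 'I_n) predT
  (fun k => is_derive_sqdist k i) x0.
apply: (is_derive_eq D); congr (_ * _); rewrite mulr_sumr.
by apply: eq_bigr => k _; rewrite mulrA.
Qed.

(** Product rule for eta F_i: since the i-th derivative of Q is 2 Q F_i, that of eta is 2 eta (1 -
    eta) F_i; the bracket without 2 F_i^2 is the derivative of F_i. *)
Lemma partial_reg_field e i : 0 < e -> let eta := sqdist_prod x / (sqdist_prod x + e) in
  partial i (reg_field e i) x =
  eta * (inv_sqdist_sum x + 2 * pole_field i x ^+ 2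
         - 2 * \sum_j (x ord0 i - a j ord0 i) ^+ 2 / sqdist j x ^+ 2)
  - 2 * eta ^+ 2 * pole_field i x ^+ 2.
Proof.
move=> e0 eta; have Qe0 := gt_eqF (sqdist_prodD_gt0 e0 x).
have D1 := is_derive_sumr
  (fun j => is_derive_mulr (is_derive_coordB j i i) (is_derive_prod_sqdist_neq j i)).
have D2 : is_derive x (v i) (fun y => (sqdist_prod y + e)^-1)
    (- (sqdist_prod x + e) ^- 2 * (sqdist_prod x * (2 * pole_field i x))).
  have [D2a D2b] := is_deriveD (is_derive_sqdist_prod i) (is_derive_cst e x (v i)).
  apply: DeriveDef; first by apply: derivableV => //; rewrite Qe0.
  by rewrite deriveV ?Qe0 // D2b addr0.
have [_ D] := is_derive_mulr D1 D2; rewrite /partial [LHS]D.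
have -> : \sum_j (x ord0 i - a j ord0 i) * \prod_(k | k != j) sqdist k x =
    sqdist_prod x * pole_field i x.
  by rewrite mulr_sumr; apply: eq_bigr => j _; rewrite prod_sqdist_neq; ring.
have -> : \sum_j ((x ord0 i - a j ord0 i) * (sqdist_prod x / sqdist j x *
       (2 * (pole_field i x - (x ord0 i - a j ord0 i) / sqdist j x))) +
     \prod_(k | k != j) sqdist k x * (i == i)%:R) =
    sqdist_prod x * (inv_sqdist_sum x + 2 * pole_field i x * pole_field i x
         - 2 * \sum_j (x ord0 i - a j ord0 i) ^+ 2 / sqdist j x ^+ 2).
  (* One factor of F_i^2 stays opaque while the other is expanded, so that the identity can be
     checked summand by summand in j. *)
  have [F FE] : exists F, F = pole_field i x by exists (pole_field i x).
  rewrite -FE [X in 2 * F * X]FE /pole_field /inv_sqdist_sum.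
  rewrite !mulr_sumr -sumrN -!big_split mulr_sumr /=.
  apply: eq_bigr => j _; rewrite prod_sqdist_neq eqxx /=.
  by field; exact: x0.
by rewrite /eta; field; rewrite Qe0.
Qed.

(** Summing over i collapses the squares to W, which gives (N - 2) W. The remainder is F . grad eta
    = 2 eta (1 - eta) |F|^2, whose sign is favourable. *)
Lemma sum_partial_reg_field e : 0 < e -> let eta := sqdist_prod x / (sqdist_prod x + e) in
  \sum_i partial i (reg_field e i) x =
  eta * ((N%:R - 2) * inv_sqdist_sum x
         + 2 * (1 - eta) * \sum_i pole_field i x ^+ 2).
Proof.
move=> e0 eta; under eq_bigr => i _ do rewrite partial_reg_field //.
rewrite -/eta sumrB -!mulr_sumr sumrB big_split /= -!mulr_sumr.
have -> : \sum_(i < N) \sum_j (x ord0 i - a j ord0 i) ^+ 2 / sqdist j x ^+ 2 =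
    inv_sqdist_sum x.
  rewrite exchange_big /=; apply: eq_bigr => j _; rewrite -mulr_suml.
  by rewrite -/(sqdist j x); field; exact: x0.
by rewrite sumr_const card_ord -mulr_natl; ring.
Qed.

End off_poles.
End poles.

(** * Interaction between the poles *)

Section cross_terms.
Variables (R : realType) (N n : nat) (a : 'I_n -> 'rV[R]_N).
Implicit Types (x : 'rV[R]_N) (i : 'I_N) (j k : 'I_n).

Lemma young2 (s p q : R) : 0 < s -> p * q <= s * p ^+ 2 + q ^+ 2 / (4 * s).
Proof.
move=> s0; rewrite -subr_ge0.
have -> : s * p ^+ 2 + q ^+ 2 / (4 * s) - p * q = (2 * s * p - q) ^+ 2 / (4 * s).
  by field; rewrite gt_eqF.
by rewrite divr_ge0 ?sqr_ge0 // mulr_ge0 // ltW.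
Qed.

Lemma sum_coordB_le (s : R) j k x : 0 < s ->
  \sum_i (x ord0 i - a j ord0 i) * (x ord0 i - a k ord0 i) <=
  s * sqdist a j x + sqdist a k x / (4 * s).
Proof.
move=> s0; rewrite /sqdist mulr_sumr mulr_suml -big_split /=.
by apply: ler_sum => i _; exact: young2.
Qed.

(** By |a_j - a_k|^2 <= 2 |x - a_j|^2 + 2 |x - a_k|^2, both distances cannot be below r. *)
Lemma sqdist_separated (r : R) j k x :
  4 * r ^+ 2 <= enorm (a j - a k) ^+ 2 -> r ^+ 2 <= sqdist a j x \/ r ^+ 2 <= sqdist a k x.
Proof.
move=> rjk; case: (leP (r ^+ 2) (sqdist a j x)) => [|rj]; first by left.
case: (leP (r ^+ 2) (sqdist a k x)) => [|rk]; first by right.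
have : enorm (a j - a k) ^+ 2 <= 2 * sqdist a j x + 2 * sqdist a k x.
  rewrite enorm_sqr /sqdist !mulr_sumr -big_split /=; apply: ler_sum => i _.
  rewrite !mxE -subr_ge0.
  have -> : 2 * (x ord0 i - a j ord0 i) ^+ 2 + 2 * (x ord0 i - a k ord0 i) ^+ 2 -
     (a j ord0 i - a k ord0 i) ^+ 2 = (2 * x ord0 i - a j ord0 i - a k ord0 i) ^+ 2 by ring.
  exact: sqr_ge0.
by move=> ?; exfalso; lra.
Qed.

Variable r : R.
Hypothesis sep : forall j k, j != k -> 0 < r /\ 4 * r ^+ 2 <= enorm (a j - a k) ^+ 2.

(** Write q_j for |x - a_j|^2. Young's inequality with weight s bounds the term by s / q_k + 1 / (4
    s q_j). If q_j >= r^2 take s = t; if q_k >= r^2 take s = 1 / (4 t), which swaps the two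
    roles. *)
Lemma cross_term_le (t : R) j k x : 0 < t -> j != k ->
  (forall l, sqdist a l x != 0) ->
  (\sum_i (x ord0 i - a j ord0 i) * (x ord0 i - a k ord0 i)) /
    (sqdist a j x * sqdist a k x) <=
  t / sqdist a j x + t / sqdist a k x + (4 * t * r ^+ 2)^-1.
Proof.
move=> t0 jk x0; have [r0 rs] := sep jk; have rjk := sqdist_separated x rs.
have q0 l : 0 < sqdist a l x by rewrite lt_def x0 sqdist_ge0.
have h s : 0 < s -> (\sum_i (x ord0 i - a j ord0 i) * (x ord0 i - a k ord0 i)) /
    (sqdist a j x * sqdist a k x) <= s / sqdist a k x + (4 * s * sqdist a j x)^-1.
  move=> s0; rewrite ler_pdivrMr ?mulr_gt0 //.
  apply: (le_trans (sum_coordB_le j k x s0)); rewrite le_eqVlt; apply/orP; left.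
  by apply/eqP; field; rewrite ?x0 ?gt_eqF.
have inv_le q : r ^+ 2 <= q -> (4 * t * q)^-1 <= (4 * t * r ^+ 2)^-1.
  move=> rq; have q1 : 0 < q by apply: lt_le_trans rq; rewrite exprn_gt0.
  by rewrite lef_pV2 ?posrE ?mulr_gt0 ?exprn_gt0 // ler_wpM2l // mulr_ge0 // ltW.
have tq l : 0 <= t / sqdist a l x by rewrite divr_ge0 // ltW.
case: rjk => rq.
  apply: (le_trans (h t t0)); apply: lerD; last exact: inv_le.
  by rewrite lerDr.
have t4 : 0 < (4 * t)^-1 by rewrite invr_gt0 mulr_gt0.
apply: (le_trans (h _ t4)).
rewrite -mulrA (_ : (4 * ((4 * t)^-1 * sqdist a j x))^-1 = t / sqdist a j x); last first.
  by field; rewrite x0 gt_eqF.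
rewrite -invfM addrC; apply: lerD; last exact: inv_le.
by rewrite lerDl.
Qed.

(** |F|^2 is a sum over n^2 pairs of poles: the diagonal sums to W and [cross_term_le] handles the
    rest. *)
Lemma pole_field_sqr_le (t : R) x : 0 < t -> (forall l, sqdist a l x != 0) ->
  \sum_i pole_field a i x ^+ 2 <=
  (1 + 2 * n%:R * t) * inv_sqdist_sum a x + n%:R ^+ 2 * (4 * t * r ^+ 2)^-1.
Proof.
move=> t0 x0.
have q0 l : 0 < sqdist a l x by rewrite lt_def x0 sqdist_ge0.
have rt0 : 0 <= (4 * t * r ^+ 2)^-1.
  by rewrite invr_ge0 mulr_ge0 ?sqr_ge0 // mulr_ge0 // ltW.
pose T j k := (\sum_i (x ord0 i - a j ord0 i) * (x ord0 i - a k ord0 i)) /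
    (sqdist a j x * sqdist a k x).
have -> : \sum_i pole_field a i x ^+ 2 = \sum_j \sum_k T j k.
  transitivity (\sum_i \sum_j \sum_k (x ord0 i - a j ord0 i) * (x ord0 i - a k ord0 i) /
    (sqdist a j x * sqdist a k x)).
    apply: eq_bigr => i _; rewrite expr2 /pole_field big_distrl /=.
    apply: eq_bigr => j _; rewrite big_distrr /=; apply: eq_bigr => k _.
    by field; rewrite !x0.
  rewrite exchange_big; apply: eq_bigr => j _.
  by rewrite exchange_big; apply: eq_bigr => k _; rewrite /T mulr_suml.
have Tjj j : T j j = (sqdist a j x)^-1.
  rewrite /T (_ : \sum_i _ = sqdist a j x); last by apply: eq_bigr => i _; rewrite expr2.
  by field; exact: x0.
pose U j k := t / sqdist a j x + t / sqdist a k x + (4 * t * r ^+ 2)^-1.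
have U0 j k : 0 <= U j k by rewrite !addr_ge0 // divr_ge0 // ltW.
apply: (@le_trans _ _ (\sum_j ((sqdist a j x)^-1 + \sum_k U j k))).
  (* The nonnegative diagonal term [U j j] is added to make the sum over k complete; with a single
     pole it is the only one. *)
  apply: ler_sum => j _; rewrite (bigD1 j) //= Tjj lerD2l.
  rewrite [leRHS](bigD1 j) //= ler_wpDl // ler_sum // => k kj.
  by apply: cross_term_le => //; rewrite eq_sym.
rewrite big_split /= -/(inv_sqdist_sum a x) mulrDl mul1r -addrA lerD2l.
set W := inv_sqdist_sum a x; set c0 := (4 * t * r ^+ 2)^-1.
have Uj j : \sum_k U j k = n%:R * t * (sqdist a j x)^-1 + (t * W + n%:R * c0).
  rewrite /U !big_split /= !sumr_const card_ord -mulr_sumr -/(inv_sqdist_sum a x) -/W -/c0.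
  by rewrite -[_ / _ *+ n]mulr_natl -[c0 *+ n]mulr_natl; ring.
rewrite (eq_bigr _ (fun j _ => Uj j)) big_split /= -mulr_sumr -/(inv_sqdist_sum a x).
rewrite -/W sumr_const card_ord.
rewrite -[_ *+ n]mulr_natl le_eqVlt; apply/orP; left; apply/eqP; ring.
Qed.

End cross_terms.

(** Everything is under [j != k], even the positivity: with one pole the radius is +oo and [fine]
    sends it to 0. *)
Lemma pole_radius_separated (R : realType) (N n : nat) (a : 'I_n -> 'rV[R]_N) :
  injective a -> forall j k, j != k ->
  0 < fine (pole_radius a) /\
  4 * fine (pole_radius a) ^+ 2 <= enorm (a j - a k) ^+ 2.
Proof.
move=> inj_a j k jk.
have enorm_gt0 (p : 'I_n * 'I_n) : p.1 != p.2 -> 0 < enorm (a p.1 - a p.2) / 2.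
  move=> p12; rewrite divr_gt0 // lt_def sqrtr_ge0 andbT -sqrf_eq0 enorm_sub_sqr.
  by apply/eqP => /sqdist_eq0 /inj_a /eqP; rewrite (negbTE p12).
have r0 : (0 < pole_radius a)%E.
  by apply: lt_bigmin => // p /enorm_gt0; rewrite lte_fin.
have rjk : (pole_radius a <= (enorm (a j - a k) / 2)%:E)%E.
  exact: (@bigmin_le_cond _ _ _ _ (j, k)).
move: r0 rjk; case: (pole_radius a) => // r; rewrite lte_fin lee_fin /= => r0 rjk.
split=> //; have : (2 * r) ^+ 2 <= enorm (a j - a k) ^+ 2.
  rewrite ler_pXn2r ?nnegrE ?sqrtr_ge0 ?mulr_ge0 ?(ltW r0) //.
  by move: rjk; rewrite ler_pdivlMr // mulrC.
by rewrite exprMn -natrX.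
Qed.

(** * The inequality between integrands *)

Section pointwise.
Variables (R : realType) (N n : nat) (a : 'I_n -> 'rV[R]_N).
Variables (b c t r e beta k1 k2 K : R) (x g : 'rV[R]_N) (m : R).
Variable u : 'rV[R]_N -> R.
Hypothesis sep : forall j k, j != k -> 0 < r /\ 4 * r ^+ 2 <= enorm (a j - a k) ^+ 2.
Hypotheses (b0 : 0 < b) (t0 : 0 < t) (e0 : 0 < e) (beta0 : 0 < beta) (m0 : 0 <= m).
Hypothesis bE : 2 * b = N%:R + k2 - 2.
Hypothesis tE : b ^+ 2 * (1 + 2 * n%:R * t) = 2 * b ^+ 2 - c.
Hypothesis K0 : 0 <= K.
Hypothesis KE : b * k1 / beta + b ^+ 2 * (n%:R ^+ 2 * (4 * t * r ^+ 2)^-1) <= K.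
Hypothesis x0 : forall j, sqdist a j x != 0.
Hypothesis H2 : (- k1 + \sum_i k2 * beta / enorm (x - a i) ^+ 2) * m <=
    beta * \sum_i dotv (x - a i) g / enorm (x - a i) ^+ 2.
Hypothesis su : smooth u.

(** Grouped as u times (u times a smooth function), so that [test_functionM] applies. *)
Definition test_field i y := u y * (u y * (b * reg_field a e i y)).

Lemma partial_test_field i : partial i (test_field i) x =
  b * u x ^+ 2 * partial i (reg_field a e i) x +
  2 * b * u x * reg_field a e i x * partial i u x.
Proof.
pose v : 'rV[R]_N := delta_mx ord0 i.
have Du : is_derive x v u (partial i u x) by apply: DeriveDef => //; exact: smooth_derivable.
have Df : is_derive x v (reg_field a e i) (partial i (reg_field a e i) x).
  by apply: DeriveDef => //; apply: smooth_derivable; exact: smooth_reg_field.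
have Db := is_derive_mulr (is_derive_cst b x v) Df.
have [_ D] := is_derive_mulr Du (is_derive_mulr Du Db).
by rewrite /partial [LHS]D /= -/(partial i u x) -/(partial i (reg_field a e i) x); ring.
Qed.

Lemma pole_field_dotv :
  \sum_i g ord0 i * pole_field a i x = \sum_j dotv (x - a j) g / enorm (x - a j) ^+ 2.
Proof.
under eq_bigr => i _ do rewrite /pole_field big_distrr /=.
rewrite exchange_big; apply: eq_bigr => j _; rewrite enorm_sub_sqr /dotv big_distrl /=.
by apply: eq_bigr => i _; rewrite !mxE; ring.
Qed.

(** The expression splits into three nonnegative pieces: m u^2 [core], b u^2 eta times the slack in
    H2, and m |grad u + b u eta F|^2. *)
Lemma pointwise_inequality :
  0 <= \sum_i (m * partial i (test_field i) x + g ord0 i * test_field i x +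
               m * partial i u x ^+ 2) +
       K * (m * u x ^+ 2) - c * (m * (u x ^+ 2 * reg_potential a e x)).
Proof.
set W := inv_sqdist_sum a x.
set F := fun i => pole_field a i x.
set eta := sqdist_prod a x / (sqdist_prod a x + e).
have Q0 := sqdist_prod_gt0 x0.
have eta0 : 0 <= eta by rewrite divr_ge0 ?ltW // sqdist_prodD_gt0.
have eta1 : eta <= 1.
  by rewrite ler_pdivrMr ?sqdist_prodD_gt0 // mul1r lerDl ltW.
have s20 : 0 <= \sum_i F i ^+ 2 by apply: sumr_ge0 => i _; exact: sqr_ge0.
set s2 := \sum_i F i ^+ 2 in s20.
have s2W : b ^+ 2 * s2 <= (2 * b ^+ 2 - c) * W + b ^+ 2 * (n%:R ^+ 2 * (4 * t * r ^+ 2)^-1).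
  by rewrite -tE -mulrA -mulrDr ler_wpM2l ?sqr_ge0 // pole_field_sqr_le.
have gF : (- k1 / beta + k2 * W) * m <= \sum_i g ord0 i * F i.
  rewrite pole_field_dotv -(ler_pM2l beta0); apply: le_trans H2.
  rewrite le_eqVlt; apply/orP; left; apply/eqP; rewrite mulrA; congr (_ * _).
  rewrite mulrDr mulrC divfK ?gt_eqF //; congr (_ + _).
  rewrite /W /inv_sqdist_sum !mulr_sumr; apply: eq_bigr => j _.
  by rewrite enorm_sub_sqr; ring.
set gf := \sum_i g ord0 i * F i in gF.
set du := \sum_i partial i u x * F i.
set G := \sum_i partial i u x ^+ 2.
have Gdu : 0 <= G + 2 * b * u x * eta * du + b ^+ 2 * u x ^+ 2 * eta ^+ 2 * s2.
  rewrite /G /du /s2 !mulr_sumr -!big_split /=; apply: sumr_ge0 => i _.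
  rewrite (_ : _ + _ = (partial i u x + b * u x * eta * F i) ^+ 2) ?sqr_ge0 //.
  by ring.
have -> : \sum_i (m * partial i (test_field i) x + g ord0 i * test_field i x +
               m * partial i u x ^+ 2) =
    m * (b * u x ^+ 2 * (eta * ((N%:R - 2) * W + 2 * (1 - eta) * s2)) +
         2 * b * u x * eta * du) + b * u x ^+ 2 * eta * gf + m * G.
  rewrite -(sum_partial_reg_field x0 e0) /G /du /gf !mulr_sumr -!big_split !mulr_sumr /=.
  rewrite -!big_split /=; apply: eq_bigr => i _.
  by rewrite partial_test_field /test_field reg_fieldE // -/eta /F; ring.
rewrite reg_potentialE // -/eta -/W.
set core := eta * (2 * b ^+ 2 * W - b ^+ 2 * eta * s2 - c * W - b * k1 / beta) +
            2 * b * eta * (1 - eta) * s2 + K.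
(* The bound on |F|^2 makes the parenthesis at least -K; since 0 <= eta <= 1 and K >= 0, eta times
   it is still at least -K. *)
have core0 : 0 <= core.
  have h1 : b ^+ 2 * eta * s2 <= b ^+ 2 * s2.
    by rewrite -mulrA ler_wpM2l ?sqr_ge0 // ler_piMl.
  have h2 : 0 <= 2 * b * eta * (1 - eta) * s2.
    apply: mulr_ge0 => //; apply: mulr_ge0; rewrite ?subr_ge0 //.
    by rewrite mulr_ge0 // mulr_ge0 // ltW.
  have h3 : - K <= 2 * b ^+ 2 * W - b ^+ 2 * eta * s2 - c * W - b * k1 / beta.
    move: KE s2W h1; move: (n%:R ^+ 2 * (4 * t * r ^+ 2)^-1) (b * k1 / beta) => C kap.
    by move: (b ^+ 2) => b2 *; lra.
  have h4 := ler_wpM2l eta0 h3.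
  have h5 : eta * K <= K by rewrite ler_piMl.
  by rewrite /core; lra.
rewrite (_ : _ - _ = m * u x ^+ 2 * core +
    b * u x ^+ 2 * eta * (gf - (- k1 / beta + k2 * W) * m) +
    m * (G + 2 * b * u x * eta * du + b ^+ 2 * u x ^+ 2 * eta ^+ 2 * s2)); last first.
  (* Here the coefficient b (N - 2 + k2) of W becomes 2 b^2. *)
  have NE : N%:R = 2 * b - k2 + 2 :> R by rewrite bE; ring.
  by rewrite NE /core; ring.
have u20 := sqr_ge0 (u x).
have bu0 : 0 <= b * u x ^+ 2 * eta by rewrite mulr_ge0 // mulr_ge0 // ltW.
have mu0 : 0 <= m * u x ^+ 2 by rewrite mulr_ge0.
by rewrite !addr_ge0 // mulr_ge0 // subr_ge0.
Qed.

End pointwise.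

(** * The regularised inequality for test functions *)

Section test_inequality.
Variables (R : realType) (N n : nat) (a : 'I_n -> 'rV[R]_N.+1).
Local Notation leb := (lebesgue_rV R N.+1).

Lemma ae_off_poles : {ae leb, forall x, forall j, sqdist a j x != 0}.
Proof.
apply: filter_forall => j; exists [set a j]; split.
- apply: closed_measurable_rV; apply: compact_closed; first exact: norm_hausdorff.
  exact: compact_set1.
- exact: lebesgue_rV_set1.
- by move=> x /= /negP; rewrite negbK => /eqP /sqdist_eq0.
Qed.

Lemma Rintegral_ae_ge0 (f : 'rV[R]_N.+1 -> R) :
  measurable_fun setT f -> {ae leb, forall x, 0 <= f x} ->
  0 <= (\int[leb]_x f x)%R.
Proof.
move=> mf f0; rewrite /Rintegral (@ae_eq_integral _ _ _ _ _ (fun x => `|(f x)%:E|%E)) //.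
- by apply: fine_ge0; apply: integral_ge0.
- exact/measurable_EFinP.
- by apply: measurableT_comp => //; exact/measurable_EFinP.
- by apply: filterS f0 => x fx _; rewrite gee0_abs // lee_fin.
Qed.

Lemma Rintegral_sum (I : Type) (s : seq I) (f : I -> 'rV[R]_N.+1 -> R) :
  (forall i, leb.-integrable setT (fun x => (f i x)%:E)) ->
  (\int[leb]_x (\sum_(i <- s) f i x))%R = \sum_(i <- s) (\int[leb]_x f i x)%R.
Proof.
move=> If; rewrite /Rintegral.
under eq_integral do rewrite -sumEFin.
rewrite integral_sum // sum_fine // => i _.
exact: integrable_fin_num.
Qed.

Variables (mu : 'rV[R]_N.+1 -> R) (gmu : 'rV[R]_N.+1 -> 'rV[R]_N.+1).
Hypothesis mu0 : forall x, 0 <= mu x.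
Hypothesis wg : weak_gradient mu gmu.

Lemma wint_Rintegral f : leb.-integrable setT (fun x => (mu x * f x)%:E) ->
  wint mu f = ((\int[leb]_x (mu x * f x))%R)%:E.
Proof.
move=> If; rewrite /Rintegral fineK; last exact: integrable_fin_num.
by apply: eq_integral => x _; rewrite mulrC.
Qed.

Variables (b c t r e beta k1 k2 K : R).
Hypothesis sep : forall j k, j != k -> 0 < r /\ 4 * r ^+ 2 <= enorm (a j - a k) ^+ 2.
Hypotheses (b0 : 0 < b) (t0 : 0 < t) (e0 : 0 < e) (beta0 : 0 < beta).
Hypothesis bE : 2 * b = N.+1%:R + k2 - 2.
Hypothesis tE : b ^+ 2 * (1 + 2 * n%:R * t) = 2 * b ^+ 2 - c.
Hypothesis K0 : 0 <= K.
Hypothesis KE : b * k1 / beta + b ^+ 2 * (n%:R ^+ 2 * (4 * t * r ^+ 2)^-1) <= K.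
Hypothesis H2 : hypothesis_H2 mu a beta k1 k2 gmu.

(** Each integrand is mu or a component of its gradient times a test function, hence integrable, so
    the claim reduces to the sign of one real integral. *)
Lemma test_inequality u : test_function u ->
  (c%:E * wint mu (fun x => (u x ^+ 2 * reg_potential a e x)%R) <=
   wint mu (fun x => (enorm (grad u x) ^+ 2)%R) + K%:E * wint mu (fun x => (u x ^+ 2)%R))%E.
Proof.
move=> tu; have [su _] := tu; have [Lmu Lg wgE] := wg.
have tu2 : test_function (fun x => u x ^+ 2).
  by under eq_fun do rewrite expr2; exact: test_functionM.
have tpu i : test_function (fun x => partial i u x ^+ 2).
  by under eq_fun do rewrite expr2; apply: test_functionM;
    [exact: smooth_partial|exact: test_function_partial].
have tV : test_function (fun x => u x ^+ 2 * reg_potential a e x).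
  by apply: test_functionM => //; exact: smooth_reg_potential.
have tw i : test_function (test_field a b e u i).
  apply: test_functionM => //; apply: smoothM => //; apply: smoothM; first exact: smooth_cst.
  exact: smooth_reg_field.
have Iu2 := integrable_test Lmu tu2.
have IV := integrable_test Lmu tV.
have Ipu i := integrable_test Lmu (tpu i).
have Ipw i := integrable_test Lmu (test_function_partial i (tw i)).
have Iw i := integrable_test (Lg i) (tw i).
have IG : leb.-integrable setT (fun x => (mu x * enorm (grad u x) ^+ 2)%:E).
  under eq_fun do rewrite enorm_sqr mulr_sumr -sumEFin.
  apply: integrable_sum => // i _.
  by apply: eq_integrable (Ipu i) => // x _; rewrite !mxE.
rewrite !wint_Rintegral // -!EFinM -EFinD lee_fin -subr_ge0.
set h := fun i x => mu x * partial i (test_field a b e u i) x +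
  gmu x ord0 i * test_field a b e u i x + mu x * partial i u x ^+ 2.
have I2 i : leb.-integrable setT (fun x => (mu x * partial i (test_field a b e u i) x +
  gmu x ord0 i * test_field a b e u i x)%:E).
  by under eq_fun do rewrite EFinD; exact: integrableD.
have Ih i : leb.-integrable setT (fun x => (h i x)%:E).
  by under eq_fun do rewrite EFinD; exact: integrableD.
have IS : leb.-integrable setT (fun x => (\sum_i h i x)%:E).
  by under eq_fun do rewrite -sumEFin; exact: integrable_sum.
have IK : leb.-integrable setT (fun x => (K * (mu x * u x ^+ 2))%:E).
  by under eq_fun do rewrite EFinM; exact: integrableZl.
have Ic : leb.-integrable setT (fun x => (c * (mu x * (u x ^+ 2 * reg_potential a e x)))%:E).
  by under eq_fun do rewrite EFinM; exact: integrableZl.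
have ISK : leb.-integrable setT (fun x => (\sum_i h i x + K * (mu x * u x ^+ 2))%:E).
  by under eq_fun do rewrite EFinD; exact: integrableD.
pose H x := \sum_i h i x + K * (mu x * u x ^+ 2) -
  c * (mu x * (u x ^+ 2 * reg_potential a e x)).
have IH : leb.-integrable setT (fun x => (H x)%:E).
  by rewrite /H; under eq_fun do rewrite EFinB; exact: integrableB.
have H0 : 0 <= (\int[leb]_x H x)%R.
  apply: Rintegral_ae_ge0.
    apply/measurable_EFinP; exact: measurable_int IH.
  apply: filterS2 ae_off_poles H2 => x x0 H2x.
  exact: (pointwise_inequality sep b0 t0 e0 beta0 (mu0 x) bE tE K0 KE x0 H2x su).
move: H0; rewrite RintegralB // RintegralD // !RintegralZl // Rintegral_sum //.
(* For each i the weak gradient identity cancels the two terms containing [test_field], leaving the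
   i-th part of the Dirichlet integral. *)
rewrite (eq_bigr (fun i => (\int[leb]_x (mu x * partial i u x ^+ 2))%R)); last first.
  move=> i _; rewrite /h RintegralD //; [|exact: I2|exact: Ipu].
  by rewrite RintegralD // ?wgE // ?addNr ?add0r //; [exact: Ipw|exact: Iw].
rewrite -Rintegral_sum //.
rewrite (@eq_Rintegral _ _ _ _ _ (fun x => mu x * enorm (grad u x) ^+ 2)) //.
by move=> x _; rewrite enorm_sqr mulr_sumr; apply: eq_bigr => i _; rewrite mxE.
Qed.

End test_inequality.

(** * Removal of the regularisation *)

Section truncation.
Variables (R : realType) (N n : nat) (a : 'I_n -> 'rV[R]_N.+1).
Local Notation leb := (lebesgue_rV R N.+1).

(** A single index drives e = 1 / (m + 1) and the cap m: lowering e raises eta, so the sequence is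
    nondecreasing, and each member is bounded as [H1_weighted_closure] requires. *)
Definition trunc_potential m x := Num.min (reg_potential a m.+1%:R^-1 x) m%:R.

Lemma trunc_potential_ge0 m x : 0 <= trunc_potential m x.
Proof. by rewrite le_min ler0n andbT reg_potential_ge0. Qed.

Lemma measurable_trunc_potential m : measurable_fun setT (trunc_potential m).
Proof.
apply: measurable_minr; last exact: measurable_cst.
by apply: continuous_measurable_rV; apply: smooth_continuous; exact: smooth_reg_potential.
Qed.

Lemma nondecreasing_trunc_potential x :
  {homo (fun m => trunc_potential m x) : m p / (m <= p)%N >-> m <= p}.
Proof.
move=> m p mp; rewrite le_min !ge_min ler_nat mp orbT andbT; apply/orP; left.
apply: ler_wpM2l; first by apply: sumr_ge0 => j _; exact: prod_sqdist_ge0.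
by rewrite lef_pV2 ?posrE ?sqdist_prodD_gt0 // lerD2l lef_pV2 ?posrE // ler_nat ltnS.
Qed.

(** Off the poles Q > 0, so eta tends to 1; as eta W <= W is finite, the cap is eventually
    inactive. *)
Lemma cvg_trunc_potential x : (forall j, sqdist a j x != 0) ->
  trunc_potential m x @[m --> \oo] --> inv_sqdist_sum a x.
Proof.
move=> x0; have Q0 := sqdist_prod_gt0 x0.
have W0 : 0 <= inv_sqdist_sum a x.
  by apply: sumr_ge0 => j _; rewrite invr_ge0 sqdist_ge0.
have cD : (sqdist_prod a x + m.+1%:R^-1) @[m --> \oo] --> sqdist_prod a x + 0.
  by apply: cvgD; [exact: cvg_cst|exact: cvg_harmonic].
have cQ : (sqdist_prod a x / (sqdist_prod a x + m.+1%:R^-1)) @[m --> \oo] -->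
    sqdist_prod a x / (sqdist_prod a x + 0).
  by apply: cvgM; [exact: cvg_cst|apply: cvgV => //; rewrite addr0 lt0r_neq0].
have cR : reg_potential a m.+1%:R^-1 x @[m --> \oo] --> inv_sqdist_sum a x.
  under eq_fun do rewrite reg_potentialE //.
  have := cvgM cQ (cvg_cst (inv_sqdist_sum a x)).
  by rewrite addr0 mulfV ?lt0r_neq0 // mul1r; exact.
apply: cvg_trans cR; apply: near_eq_cvg; near=> m.
rewrite /trunc_potential; apply/esym/min_idPl.
apply: (@le_trans _ _ (inv_sqdist_sum a x)); last by near: m; exact: nbhs_infty_ger.
rewrite reg_potentialE // ler_piMl // ler_pdivrMr ?sqdist_prodD_gt0 // mul1r.
by rewrite lerDl ltW.
Unshelve. all: by end_near. Qed.

(* q^-1 = lim q / (q^2 + 1 / (m + 1)), also at the pole, where 0^-1 = 0. *)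
Lemma measurable_inv_sqdist j : measurable_fun setT (fun x => (sqdist a j x)^-1).
Proof.
pose h m x := sqdist a j x * (sqdist a j x * sqdist a j x + m.+1%:R^-1)^-1.
have qq0 m x : 0 < sqdist a j x * sqdist a j x + m.+1%:R^-1.
  by rewrite ltr_wpDl // mulr_ge0 // sqdist_ge0.
apply: (@measurable_fun_cvg _ _ _ _ h) => [m|x _].
  apply: continuous_measurable_rV; apply: smooth_continuous.
  apply: smoothM; first exact: smooth_sqdist.
  apply: smoothV => [x|]; first exact: lt0r_neq0.
  apply: smoothD; last exact: smooth_cst.
  by apply: smoothM; exact: smooth_sqdist.
have [q0|q0] := eqVneq (sqdist a j x) 0.
  rewrite q0 invr0 (_ : h ^~ x = fun=> 0); first exact: cvg_cst.
  by apply/funext => m; rewrite /h q0 mul0r.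
have cD : (sqdist a j x * sqdist a j x + m.+1%:R^-1) @[m --> \oo] -->
    sqdist a j x * sqdist a j x + 0.
  by apply: cvgD; [exact: cvg_cst|exact: cvg_harmonic].
rewrite (_ : (sqdist a j x)^-1 = sqdist a j x * (sqdist a j x * sqdist a j x + 0)^-1); last first.
  by rewrite addr0; field.
apply: cvgM; first exact: cvg_cst.
by apply: cvgV => //; rewrite addr0 mulf_neq0.
Qed.

Variable mu : 'rV[R]_N.+1 -> R.
Hypothesis mu0 : forall x, 0 <= mu x.
Hypothesis mmu : measurable_fun setT mu.

(** Monotone convergence. At a pole the term divided by zero is 0 and the limit may be wrong, but
    the poles form a null set. *)
Lemma wint_inv_sqdist_le (f : 'rV[R]_N.+1 -> R) (c : R) (B : \bar R) :
  measurable_fun setT f -> 0 <= c ->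
  (forall m, c%:E * wint mu (fun x => (f x ^+ 2 * trunc_potential m x)%R) <= B)%E ->
  (c%:E * wint mu (fun x => \sum_i f x ^+ 2 / enorm (x - a i) ^+ 2)%R <= B)%E.
Proof.
move=> mf c0 fB.
pose g m x := ((f x ^+ 2 * trunc_potential m x) * mu x)%:E.
have mg m : measurable_fun setT (g m).
  apply/measurable_EFinP; apply: measurable_funM => //; apply: measurable_funM.
    exact: measurable_funX.
  exact: measurable_trunc_potential.
have g0 m x : setT x -> (0 <= g m x)%E.
  by move=> _; rewrite lee_fin mulr_ge0 // mulr_ge0 ?sqr_ge0 ?trunc_potential_ge0.
have ndg x : setT x -> nondecreasing_seq (g ^~ x).
  move=> _ m p mp; rewrite lee_fin ler_wpM2r // ler_wpM2l ?sqr_ge0 //.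
  exact: nondecreasing_trunc_potential.
have gE x : (forall j, sqdist a j x != 0) ->
    limn (g ^~ x) = ((\sum_i f x ^+ 2 / enorm (x - a i) ^+ 2) * mu x)%:E.
  move=> x0; apply/cvg_lim => //; apply/fine_cvgP; split; first exact: nearW.
  rewrite /g /= (_ : \sum_i _ = f x ^+ 2 * inv_sqdist_sum a x); last first.
    by rewrite mulr_sumr; apply: eq_bigr => j _; rewrite enorm_sub_sqr.
  by apply: cvgMl; apply: cvgMr; exact: cvg_trunc_potential.
have mW : measurable_fun setT
    (fun x => ((\sum_i f x ^+ 2 / enorm (x - a i) ^+ 2) * mu x)%:E).
  apply/measurable_EFinP; apply: measurable_funM => //.
  apply: measurable_sum => i; apply: measurable_funM; first exact: measurable_funX.
  under eq_fun do rewrite enorm_sub_sqr.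
  exact: measurable_inv_sqdist.
have C := @cvg_monotone_convergence _ _ _ leb _ measurableT g mg g0 ndg.
have -> : wint mu (fun x => \sum_i f x ^+ 2 / enorm (x - a i) ^+ 2)%R =
    (\int[leb]_x limn (g ^~ x))%E.
  apply: ae_eq_integral => //.
    by apply: (emeasurable_fun_cvg g) => // x _; apply: ereal_nondecreasing_is_cvgn; exact: ndg.
  by apply: filterS (ae_off_poles a) => x x0 _; rewrite gE.
have cfin : c%:E \is a fin_num by [].
have C' := cvgeZl cfin C.
rewrite -(cvg_lim _ C') //; apply: lime_le;
  first by apply/cvg_ex; exists (c%:E * (\int[leb]_x limn (g ^~ x)))%E.
by apply: nearW => m; exact: fB.
Qed.

End truncation.

(** * Choice of the constants and conclusion *)

Theorem theorem2p2 (R : realType) (N : nat) (beta k1 k2 : R)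
    (hN : (3 <= N)%N) (hbeta : 0 < beta) (hk2 : 2 - N%:R < k2) :
  exists K : nat -> R -> \bar R -> R,
  forall (n : nat) (a : 'I_n -> 'rV[R]_N)
    (mu : 'rV[R]_N -> R) (gmu : 'rV[R]_N -> 'rV[R]_N) (c : R),
    (1 <= n)%N ->
    injective a ->
    (forall x, 0 <= mu x) ->
    hypothesis_H1 mu gmu ->
    hypothesis_H2 mu a beta k1 k2 gmu ->
    0 < c < hardy_const (N%:R + k2) ->
    forall (phi : 'rV[R]_N -> R) (gphi : 'rV[R]_N -> 'rV[R]_N),
      H1_weighted mu phi gphi ->
      (c%:E * wint mu (fun x => \sum_i phi x ^+ 2 / enorm (x - a i) ^+ 2)%R
       <= wint mu (fun x => enorm (gphi x) ^+ 2)%R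
          + (K n c (pole_radius a))%:E * wint mu (fun x => phi x ^+ 2)%R)%E.
Proof.
case: N hN hk2 => [//|N'] _ hk2'.
(* This b maximises b (N + k2 - 2) - b^2, with maximum c_o = b^2; it is positive because k2 > 2 -
   N. *)
pose b : R := (N'.+1%:R + k2 - 2) / 2.
have b0 : 0 < b by rewrite divr_gt0 //; lra.
(* The solution of b^2 (1 + 2 n t) = 2 b^2 - c, positive exactly because c < b^2. *)
pose t (n : nat) (c : R) := (b ^+ 2 - c) / (2 * n%:R * b ^+ 2).
(* For a single pole [fine] maps +oo to 0 and 0^-1 = 0, so the cross-term constant disappears. The
   maximum with 0 provides K >= 0. *)
exists (fun n c rho => Num.max 0
  (b * k1 / beta + b ^+ 2 * (n%:R ^+ 2 * (4 * t n c * fine rho ^+ 2)^-1))).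
move=> n a mu gmu c n1 inj_a mu0 [wg _ _] H2 /andP[c0 cb] phi gphi Hphi.
set K := Num.max 0 _.
have K0 : 0 <= K by rewrite le_max lexx.
have [Lmu _ _] := wg.
have mmu : measurable_fun setT mu by apply/measurable_EFinP; exact: Lmu.1.
have n0 : (0 : R) < n%:R by rewrite ltr0n.
have cb2 : c < b ^+ 2 by exact: cb.
have t0 : 0 < t n c by rewrite divr_gt0 ?subr_gt0 // mulr_gt0 ?exprn_gt0 // mulr_gt0.
have tE : b ^+ 2 * (1 + 2 * n%:R * t n c) = 2 * b ^+ 2 - c.
  by rewrite /t; field; rewrite !lt0r_neq0.
have [mphi _ _ _] := Hphi.
apply: (wint_inv_sqdist_le (a := a)) => // [|m]; first exact: ltW.
have e0 : (0 : R) < m.+1%:R^-1 by rewrite invr_gt0.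
apply: (H1_weighted_closure mu0 mmu (M := m%:R)) => //.
- exact: measurable_trunc_potential.
- exact: trunc_potential_ge0.
- by move=> x; rewrite ge_min lexx orbT.
- exact: ltW.
move=> u tu; apply: (@le_trans _ _
    (c%:E * wint mu (fun x => u x ^+ 2 * reg_potential a m.+1%:R^-1 x)%R)%E).
  apply: lee_wpmul2l; first by rewrite lee_fin ltW.
  have mu2 : measurable_fun setT (fun x => u x ^+ 2).
    by apply: measurable_funX; exact: measurable_test_function.
  apply: le_wint => // [|||x].
  - by apply: measurable_funM => //; exact: measurable_trunc_potential.
  - apply: measurable_funM => //; apply: continuous_measurable_rV.
    by apply: smooth_continuous; exact: smooth_reg_potential.
  - by move=> x; rewrite mulr_ge0 ?sqr_ge0 ?trunc_potential_ge0.
  - by rewrite ler_wpM2l ?sqr_ge0 // ge_min lexx.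
apply: (test_inequality mu0 wg (pole_radius_separated inj_a) b0 t0 e0 hbeta _ tE K0 _ H2) => //.
  by rewrite /b; field.
by rewrite le_max lexx orbT.
Qed.
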